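(* There exists a universal constant $C$ such that for every log-concave probability measure $\mu$ on the real line, $$C_P(\mu)\le C\,\mathrm{Var}_\mu(x).$$
   Context: A log-concave probability measure on $\mathbb{R}$ is a probability measure $\mu(dx)=Z^{-1}e^{-V(x)}dx$ with $V$ convex with values in $]-\infty,+\infty]$. $C_P(\mu)$ is the best constant $C_P$ in the Poincaré inequality $\mathrm{Var}_\mu(f)\le C_P\int (f')^2d\mu$ for all smooth $f$. $\mathrm{Var}_\mu(x)$ is the variance of the identity function under $\mu$. *)

(* Defs.v *)
From HB Require Import structures.
From mathcomp Require Import all_boot all_order all_algebra.
From mathcomp Require Import all_classical all_reals all_analysis.
Set Implicit Arguments.
Unset Strict Implicit.
Unset Printing Implicit Defensive.
Import Order.TTheory GRing.Theory Num.Theory.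
Import numFieldNormedType.Exports.

Local Open Scope classical_set_scope.
Local Open Scope ring_scope.
Local Open Scope ereal_scope.

(* The library's [convex_function] only covers real-valued functions. The
   endpoints t = 0, 1 are harmless since 0 * +oo = 0 in [\bar R]. *)
Definition econvex (R : realType) (V : R -> \bar R) : Prop :=
  forall (x y t : R), (0 <= t <= 1)%R ->
    V (t * x + (1 - t) * y)%R <= t%:E * V x + (1 - t)%:E * V y.

(* Z need not be tied explicitly to the integral of e^{-V}: taking A = setT,
   the total mass 1 of mu forces it to be that integral. *)
Definition log_concave (R : realType)
    (mu : probability (measurableTypeR R) R) : Prop :=
  exists (V : R -> \bar R) (Z : R),
    [/\ forall x, -oo < V x,
        econvex V,
        (0 < Z)%R &
        forall A : set (measurableTypeR R), measurable A ->
          mu A = (Z^-1)%:E * \int[lebesgue_measure]_(x in A) expeR (- V x)].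

Definition smooth (R : realType) (f : R -> R) : Prop :=
  forall (n : nat) (x : R), derivable (derive1n n f) x 1%R.

(* Both sides take values in [\bar R]. A smooth f is not assumed to be square
   integrable: when it is not, its variance ['V_mu[f]] is +oo. *)
Definition poincare_ineq (R : realType)
    (mu : probability (measurableTypeR R) R) (c : R) : Prop :=
  forall f : R -> R, smooth f ->
    'V_mu[f] <= c%:E * \int[mu]_x ((derive1 f x) ^+ 2)%:E.

(* Equal to +oo when no Poincare inequality holds. *)
Definition poincare_constant (R : realType)
    (mu : probability (measurableTypeR R) R) : \bar R :=
  ereal_inf [set c%:E | c in [set c : R | (0 <= c)%R /\ poincare_ineq mu c]].

(* Main.v *)
Require Import Defs.
From HB Require Import structures.
From mathcomp Require Import all_boot all_order all_algebra.
From mathcomp Require Import all_classical all_reals all_analysis.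
From mathcomp Require Import measurable_realfun.
From mathcomp Require Import ring lra.
Set Implicit Arguments.
Unset Strict Implicit.
Unset Printing Implicit Defensive.
Import Order.TTheory GRing.Theory Num.Theory.
Import numFieldNormedType.Exports.
Local Open Scope classical_set_scope.
Local Open Scope ring_scope.

(** A log-concave probability density [r] lives at a single length scale,
    [1 / M] with [M = sup r]. On the one hand no interval of length [l] carries
    mass more than [l * M], so half of the mass is at distance at least
    [1 / (4 * M)] from the mean, and the variance is at least
    [1 / (32 * M ^+ 2)] ([variance_id_ge]). On the other hand, take [m] with
    [sup r <= 2 * r m]. If [r] did not lose a factor [e] within a distance
    comparable to [1 / r m], it would have mass more than [1] there; after that,
    log-concavity forces exponential decay at the same rate. This yields, with
    [be] proportional to [r m], the kernel bound
      [r x <= 2 * e * r t * expR (- be * `|x - t|)]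
    whenever [t] lies between [m] and [x] ([log_concave_fun_decay_sym]).

    The kernel bound gives a Poincare inequality with constant of order
    [1 / be ^+ 2]. The variance of [f] is at most the integral of
    [(f - f m) ^+ 2]. Differentiating [expR (- al * t) * (f t - f m) ^+ 2] and
    completing a square bounds [(f x - f m) ^+ 2] by the integral of
    [al^-1 * expR (al * `|x - t|) * f'(t) ^+ 2] for [t] between [m] and [x]
    ([sqr_increment_le]). Integrating against [r x] and exchanging the integrals
    with Tonelli's theorem, the factor [r x * expR (al * `|x - t|)] becomes at
    most [2 * e * r t * expR (- (be - al) * `|x - t|)], whose integral in [x] is
    a multiple of [r t] ([weighted_poincare]). With [al = be / 2] the Poincare
    constant obtained and the lower bound on the variance are both multiples of
    [1 / r m ^+ 2], and comparing them gives the theorem.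

    A test function [f] need not be square integrable: everything is estimated
    by integrals of nonnegative functions, so the finiteness of the variance of
    [f], when [f'] is square integrable, comes out of the argument. *)

(** * Log-concave functions of one variable *)

Section log_concave_functions.
Context {R : realType}.
Implicit Types (r : R -> R) (a b m x y t c u v D : R).

(** Concavity of [ln r], stated without the logarithm so that [r] may vanish:
    a function is concave iff it stays quasi-concave after subtraction of any
    linear function, and multiplication of [r] by [expR (- b * t)] subtracts a
    linear function of slope [b] from [ln r]. The factors below are normalized
    at [t]. *)
Definition log_concave_fun r := forall b x y t, x <= t <= y ->
  Num.min (r x * expR (b * (t - x))) (r y * expR (b * (t - y))) <= r t.

(** The only way in which the total mass [1] of [r] enters the estimates of this
    part; in this form it is stable under reflection without any measure
    theory. *)
Definition mass_le1 r := forall c u v, u <= v ->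
  (forall y, u <= y <= v -> c <= r y) -> c * (v - u) <= 1.

Lemma log_concave_funN r : log_concave_fun r -> log_concave_fun (r \o -%R).
Proof.
move=> lr b x y t /andP[xt ty]; rewrite minC /=.
have := lr (- b) (- y) (- x) (- t); rewrite !lerN2 xt ty => /(_ isT).
by rewrite !mulNr -!mulrN !opprD !opprK.
Qed.

Lemma mass_le1N r : mass_le1 r -> mass_le1 (r \o -%R).
Proof.
move=> mr c u v uv cr.
have := mr c (- v) (- u); rewrite lerN2 => /(_ uv).
rewrite opprK addrC; apply => y /andP[vy yu].
by have := cr (- y); rewrite /= opprK; apply; rewrite lerNr yu lerNl vy.
Qed.

Lemma log_concave_fun_min r x y t : log_concave_fun r -> x <= t <= y ->
  Num.min (r x) (r y) <= r t.
Proof. by move=> lr /(lr 0); rewrite !mul0r expR0 !mulr1. Qed.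

(** If [r] is above an exponential through its value at [x] when it reaches [y],
    it was above that exponential all the way from [x] to [y]. *)
Lemma log_concave_fun_ge_exp r b x y t : log_concave_fun r -> x <= t <= y ->
  r x * expR (b * (y - x)) <= r y -> r x * expR (b * (t - x)) <= r t.
Proof.
move=> lr xty xy; apply: le_trans (lr b _ _ _ xty); rewrite le_min lexx /=.
have -> : b * (t - x) = b * (y - x) + b * (t - y) by ring.
by rewrite expRD mulrA ler_pM2r ?expR_gt0.
Qed.

(** The opposite comparison at [y] makes the exponential through the value at
    [y] the lower barrier: an average decay from [x] to [y] at rate [- b] holds
    at least at that rate from any intermediate point on. *)
Lemma log_concave_fun_le_exp r b x y t : log_concave_fun r -> x <= t <= y ->
  r y <= r x * expR (b * (y - x)) -> r y * expR (b * (t - y)) <= r t.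
Proof.
move=> lr xty xy; apply: le_trans (lr b _ _ _ xty); rewrite le_min lexx andbT.
have -> : b * (t - x) = b * (y - x) + b * (t - y) by ring.
by rewrite expRD mulrA ler_pM2r ?expR_gt0.
Qed.

(** A larger value at [x] would put [r] above an exponential with base point
    [a], which on the second half of [[a, x]] has mass more than [1]. *)
Lemma log_concave_fun_le_far r a x D : log_concave_fun r -> mass_le1 r ->
  0 < r a -> 0 < D -> a + D <= x -> r x <= r a * expR (4 / (D * r a)).
Proof.
move=> lr mr ra D0 Dx; rewrite leNgt; apply/negP => /ltW h.
(* This value makes [r a * (K / 2) * (D / 2) = 1]. *)
set K := 4 / (D * r a) in h.
have d0 : 0 < x - a by lra.
have K0 : 0 < K by rewrite divr_gt0 ?mulr_gt0.
have ge y : (a + x) / 2 <= y <= x -> r a * (1 + K / 2) <= r y.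
  move=> /andP[ay yx].
  have /(log_concave_fun_ge_exp (b := K / (x - a)) lr) : a <= y <= x by lra.
  rewrite divfK ?gt_eqF// => /(_ h); apply: le_trans.
  rewrite ler_pM2l//; apply: le_trans (expR_ge1Dx _) _; rewrite ler_expR.
  rewrite -[leRHS]mulrA ler_pM2l// [leRHS]mulrC ler_pdivlMr//; lra.
have : r a * (1 + K / 2) * (x - (a + x) / 2) <= 1 by apply: mr ge; lra.
apply/negP; rewrite -ltNge (_ : x - _ = (x - a) / 2); last by field.
have -> : r a * (1 + K / 2) * ((x - a) / 2) =
    r a * (x - a) / 2 + (x - a) / D by rewrite /K; field; rewrite !gt_eqF.
have : 1 <= (x - a) / D by rewrite ler_pdivlMr// mul1r lerBrDl.
have : 0 < r a * (x - a) by rewrite mulr_gt0.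
lra.
Qed.

(** Two base points are needed because the bound of [log_concave_fun_le_far]
    degenerates near its base point; every [x] is far from [a] on its right or
    far from [b] on its left. *)
Lemma log_concave_fun_bounded r a b : log_concave_fun r -> mass_le1 r ->
  a < b -> 0 < r a -> 0 < r b -> exists M, forall x, r x <= M.
Proof.
move=> lr mr ab ra rb; pose D := (b - a) / 2.
have D0 : 0 < D by rewrite /D; lra.
pose B c := r c * expR (4 / (D * r c)).
exists (Num.max (B a) (B b)) => x; rewrite le_max.
have [ax|xa] := leP (a + D) x; first by rewrite (log_concave_fun_le_far lr).
apply/orP; right.
have := @log_concave_fun_le_far (r \o -%R) (- b) (- x) D.
rewrite /= !opprK; apply => //.
- exact: log_concave_funN.
- exact: mass_le1N.
- by rewrite /D in xa *; lra.
Qed.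

(** A log-concave density need not attain its supremum (it may jump down at an
    endpoint of its support), so half of the supremum has to do. *)
Lemma exists_near_max r a M : 0 < r a -> (forall x, r x <= M) ->
  exists2 m, 0 < r m & forall x, r x <= 2 * r m.
Proof.
move=> ra rM.
have hs : has_sup (range r) by split; [exists (r a), a|exists M => _ [x _ <-]].
have S0 : 0 < sup (range r).
  by apply: lt_le_trans ra _; apply: sup_upper_bound => //; exists a.
have [|_ [m _ <-] mS] := @sup_adherent _ _ (sup (range r) / 2) _ hs; first lra.
exists m => [|x]; first lra.
have : r x <= sup (range r) by apply: sup_upper_bound => //; exists x.
lra.
Qed.

(** With [B = r m * expR (-2)], the mass bound at the scale [B^-1] forces
    [r x <= r m * expR (- B * (x - m))] as soon as [x] is further than [B^-1]
    from [m], and by log-concavity this average rate from [m] to [x] is achieved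
    from [t] to [x] as well. At distance at most [B^-1] the exponential loses no
    more than a factor [expR 1] and near-maximality of [r m] suffices. *)
Lemma log_concave_fun_decay r m t x : (forall y, 0 <= r y) ->
  log_concave_fun r -> mass_le1 r ->
  0 < r m -> (forall y, r y <= 2 * r m) -> m <= t <= x ->
  r x <= 2 * expR 1 * r t * expR (- (r m * expR (-2)) * (x - t)).
Proof.
move=> r0 lr mr rm rmax mtx; have /andP[mt tx] := mtx.
set B := r m * expR (-2).
have B0 : 0 < B by rewrite mulr_gt0 ?expR_gt0.
have [xs|xl] := leP (x - m) B^-1.
  have rt : r x <= 2 * r t.
    have := log_concave_fun_min lr mtx.
    by rewrite ge_min => /orP[]; have := rmax x; have := r0 t; lra.
  apply: (le_trans rt); rewrite -!mulrA ler_pM2l// mulrCA -expRD.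
  rewrite ler_peMr// -[leLHS]expR0 ler_expR mulNr subr_ge0 -(divff (lt0r_neq0 B0)).
  by rewrite ler_pM2l// (le_trans _ xs)// lerD2l lerN2.
(* Otherwise [r >= r m * expR (-1)] on an interval of length [B^-1], which has
   mass at least [expR 1 > 1]. *)
have /(log_concave_fun_le_exp lr mtx) : r x <= r m * expR (- B * (x - m)).
  rewrite leNgt; apply/negP => /ltW h.
  have Bi0 : 0 < B^-1 by rewrite invr_gt0.
  have ge y : m <= y <= m + B^-1 -> r m * expR (- 1) <= r y.
    move=> /andP[my yB].
    have /(log_concave_fun_ge_exp lr) /(_ h) : m <= y <= x by lra.
    apply: le_trans; rewrite ler_pM2l// ler_expR mulNr lerN2.
    by rewrite -(divff (lt0r_neq0 B0)) ler_pM2l// lerBlDl.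
  have : r m * expR (-1) * (m + B^-1 - m) <= 1 by apply: mr ge; lra.
  apply/negP; rewrite -ltNge (_ : m + B^-1 - m = B^-1); last by ring.
  have -> : r m * expR (-1) / B = expR 1.
    rewrite /B invfM -expRN opprK mulrACA divff ?gt_eqF// mul1r -expRD.
    by congr expR; ring.
  by rewrite expR_gt1.
rewrite mulNr -mulrN opprB => h.
rewrite mulNr expRN ler_pdivlMr ?expR_gt0// (le_trans h)// ler_peMl//.
have := @expR_gt1 R 1; rewrite ltr01; lra.
Qed.

Lemma log_concave_fun_decay_sym r m t x : (forall y, 0 <= r y) ->
  log_concave_fun r -> mass_le1 r ->
  0 < r m -> (forall y, r y <= 2 * r m) -> (m <= t <= x) || (x <= t <= m) ->
  r x <= 2 * expR 1 * r t * expR (- (r m * expR (-2)) * `|x - t|).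
Proof.
move=> r0 lr mr rm rmax /orP[mtx|/andP[xt tm]].
  rewrite ger0_norm; first exact: log_concave_fun_decay.
  by rewrite subr_ge0; case/andP: mtx.
rewrite ler0_norm ?subr_le0//.
have := @log_concave_fun_decay (r \o -%R) (- m) (- t) (- x).
rewrite /= !opprK opprB addrC; apply => //.
- exact: log_concave_funN.
- exact: mass_le1N.
- by rewrite !lerN2 tm.
Qed.

End log_concave_functions.

(** * The density of a log-concave measure *)

Section density.
Context {R : realType}.
Local Notation leb := (@lebesgue_measure R).

Definition has_density (mu : probability (measurableTypeR R) R) (r : R -> R) :=
  forall A : set (measurableTypeR R), measurable A ->
    (mu A = \int[leb]_(x in A) (r x)%:E)%E.

(** The superlevel sets are intervals. *)
Lemma log_concave_fun_measurable (r : R -> R) :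
  log_concave_fun r -> measurable_fun setT r.
Proof.
move=> lr; apply: (measurability (@RGenCInfty.G R)) => [|/= _ [_] [c] -> <-].
  exact: RGenCInfty.measurableE.
apply: measurableI => //; apply: is_interval_measurable => x y /=.
rewrite !in_itv/= !andbT => cx cy t xty; rewrite in_itv/= andbT.
by apply: le_trans (log_concave_fun_min lr xty); rewrite le_min cx.
Qed.

(** If [t = l * x + (1 - l) * y], the [l]-weighted average of the exponents at
    [x] and at [y] is [- (l * V x + (1 - l) * V y)], because the linear terms of
    slope [b] cancel. By convexity this is at most [- V t], hence so is one of
    the two exponents. *)
Lemma econvex_log_concave_fun (V : R -> \bar R) (Z : R) : 0 < Z ->
  (forall x, -oo < V x)%E -> econvex V ->
  log_concave_fun (fun x => Z^-1 * fine (expeR (- V x)%E)).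
Proof.
move=> Z0 VNy cV b x y t /andP[]; rewrite le_eqVlt => /predU1P[<- _|xt].
  by rewrite subrr mulr0 expR0 mulr1 ge_min lexx.
rewrite le_eqVlt => /predU1P[<-|ty].
  by rewrite subrr mulr0 expR0 mulr1 ge_min lexx orbT.
have rt0 : 0 <= Z^-1 * fine (expeR (- V t)).
  by rewrite mulr_ge0 ?invr_ge0 ?(ltW Z0)// fine_ge0// expeR_ge0.
have := VNy x; have := VNy y; have := VNy t.
case Ex : (V x) => [v| |] //=; last by rewrite mulr0 mul0r ge_min rt0.
case Ey : (V y) => [w| |] //=; last by rewrite mulr0 mul0r ge_min rt0 orbT.
pose l := (y - t) / (y - x).
have yx : 0 < y - x by lra.
have l01 : 0 <= l <= 1.
  by rewrite divr_ge0 ?ler_pdivrMr//=; lra.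
have := cV x y l l01; rewrite Ex Ey.
have -> : l * x + (1 - l) * y = t by rewrite /l; field; rewrite gt_eqF.
case Et : (V t) => [u| |] //=; rewrite -!EFinM -EFinD lee_fin => ule _ _ _.
rewrite -!mulrA -!expRD -minr_pMr ?invr_ge0 ?(ltW Z0)//.
rewrite ler_pM2l ?invr_gt0// ge_min !ler_expR.
have tE : l * (t - x) + (1 - l) * (t - y) = 0 by rewrite /l; field; rewrite gt_eqF.
rewrite -[_ || _]negbK negb_or -!ltNge; apply/negP => /andP[ux uy].
have : l * (- v + b * (t - x) + u) + (1 - l) * (- w + b * (t - y) + u) =
  b * (l * (t - x) + (1 - l) * (t - y)) + (u - (l * v + (1 - l) * w)) by ring.
rewrite tE mulr0 add0r => E.
have lE : l = 0 \/ 0 < l by case/andP: l01; rewrite le_eqVlt => /predU1P[<-|]; auto.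
case: lE => [l0|l0]; first by move: E ule; rewrite l0; lra.
have : 0 < l * (- v + b * (t - x) + u) by rewrite mulr_gt0//; lra.
have : 0 <= (1 - l) * (- w + b * (t - y) + u) by rewrite mulr_ge0//; lra.
lra.
Qed.

(** The Radon-Nikodym derivative of [mu] is almost everywhere equal to [r], as
    they have the same integral over every measurable set. *)
Lemma integral_of_density (mu : probability (measurableTypeR R) R) (r : R -> R) :
  (forall x, 0 <= r x) -> measurable_fun setT r -> has_density mu r ->
  forall g : measurableTypeR R -> \bar R, (forall x, 0 <= g x)%E ->
  measurable_fun setT g ->
  (\int[mu]_x g x = \int[leb]_x (g x * (r x)%:E))%E.
Proof.
move=> r0 mr muE g g0 mg.
have mEr : measurable_fun setT (EFin \o r) by exact/measurable_EFinP.
have muleb : mu `<< leb.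
  apply/null_content_dominatesP => A mA leA; rewrite muE//.
  by apply: null_set_integral => //; exact: measurable_funTS.
rewrite -(Radon_Nikodym_SigmaFinite.change_of_variables muleb)//.
have ir := Radon_Nikodym_SigmaFinite.f_integrable muleb.
apply: ae_eq_integral => //.
- by apply: emeasurable_funM => //; exact: measurable_int ir.
- exact: emeasurable_funM.
- apply: ae_eqe_mul2l; apply: integral_ae_eq => //= E _ mE.
  by rewrite -muE// -Radon_Nikodym_SigmaFinite.f_integral.
Qed.

Lemma log_concave_density (mu : probability (measurableTypeR R) R) :
  log_concave mu -> exists r : R -> R,
  [/\ forall x, 0 <= r x, log_concave_fun r & has_density mu r].
Proof.
move=> [V [Z [VNy cV Z0 muE]]].
pose r x := Z^-1 * fine (expeR (- V x)%E).
have r0 x : 0 <= fine (expeR (- V x)) by rewrite fine_ge0// expeR_ge0.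
have lr : log_concave_fun r by exact: econvex_log_concave_fun.
exists r; split => //.
  by move=> x; rewrite mulr_ge0// invr_ge0 ltW.
move=> A mA; rewrite muE//.
have eE x : expeR (- V x) = (fine (expeR (- V x)))%:E.
  by have := VNy x; case: (V x).
under eq_integral do rewrite eE.
rewrite -ge0_integralZl//=.
- apply/measurable_EFinP/measurable_funTS.
  rewrite (_ : (fun x => _) = Z \*o r); last first.
    by apply/funext => x; rewrite /r/= mulVKf// gt_eqF.
  by apply: measurable_funM => //; exact: log_concave_fun_measurable.
- by move=> x _; rewrite lee_fin.
- by rewrite lee_fin invr_ge0 ltW.
Qed.

Lemma density_mass_le1 (mu : probability (measurableTypeR R) R) (r : R -> R) :
  (forall x, 0 <= r x) -> measurable_fun setT r -> has_density mu r -> mass_le1 r.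
Proof.
move=> r0 mr muE c u v uv cr.
have [c0|c0] := leP c 0.
  by apply: (@le_trans _ _ 0) => //; rewrite mulr_le0_ge0// subr_ge0.
have : (\int[leb]_(x in `[u, v]) c%:E <= 1)%E.
  apply: (@le_trans _ _ (mu `[u, v]%classic)); last exact: probability_le1.
  rewrite muE//.
  apply: ge0_le_integral => //.
  - by move=> x _; rewrite lee_fin ltW.
  - by apply/measurable_EFinP/measurable_funTS.
rewrite integral_cst//= lebesgue_measure_itv/= lte_fin.
have [uv'|vu _] := ltP u v; first by rewrite -EFinD -EFinM lee_fin.
suff -> : u = v by rewrite subrr mulr0.
by apply/eqP; rewrite eq_le uv vu.
Qed.

(** A single point is Lebesgue-negligible and cannot carry all the mass. *)
Lemma density_support (mu : probability (measurableTypeR R) R) (r : R -> R) :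
  (forall x, 0 <= r x) -> measurable_fun setT r -> has_density mu r ->
  exists a b, [/\ a < b, 0 < r a & 0 < r b].
Proof.
move=> r0 mr muE.
have ex a : exists2 b, b != a & 0 < r b.
  apply: contrapT => nex.
  have r00 b : b != a -> r b = 0.
    move=> ba; apply/eqP; rewrite eq_le r0 andbT leNgt; apply/negP => rb.
    by apply: nex; exists b.
  suff : mu setT = 0%E by rewrite probability_setT => /eqP; rewrite eqe oner_eq0.
  rewrite -(setUv [set a]) measureU//; last first.
    by rewrite setICr.
    exact: measurableC.
  rewrite [X in (X + _)%E](etrans (muE _ _) (integral_set1 _ _))//.
  rewrite add0e [LHS]muE; last exact: measurableC.
  apply: integral0_eq => x /= xa.
  by rewrite r00//; exact/eqP.
have [a _ ra] := ex 0; have [b ba rb] := ex a.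
by have [ab|ab] := ltP a b; [exists a, b|exists b, a]; split => //; rewrite lt_neqAle ba.
Qed.

End density.

(** * Pointwise control of a smooth function by its derivative *)

Section pointwise.
Context {R : realType}.
Local Notation leb := (@lebesgue_measure R).
Implicit Types (f F h : R -> R).

Lemma smooth_derivable f x : smooth f -> derivable f x 1.
Proof. by move=> /(_ 0%N). Qed.

Lemma smooth_continuous f : smooth f -> continuous f.
Proof.
by move=> sf x; apply/differentiable_continuous/derivable1_diffP/smooth_derivable.
Qed.

Lemma smooth_continuous_derive1 f : smooth f -> continuous (derive1 f).
Proof.
by move=> sf x; apply/differentiable_continuous/derivable1_diffP; exact: (sf 1%N).
Qed.

Lemma FTC2_le F F' h u v : u < v ->
  (forall t : R, is_derive t 1 F (F' t)) -> continuous F' -> continuous h ->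
  (forall t, F' t <= h t) ->
  ((F v - F u)%:E <= \int[leb]_(t in `[u, v]) (h t)%:E)%E.
Proof.
move=> uv dF cF' ch le.
have cF : continuous F.
  by move=> t; apply/differentiable_continuous/derivable1_diffP/ex_derive.
rewrite EFinB -(@continuous_FTC2 _ F' F u v)//.
- apply: le_integral => //.
  + by apply: continuous_compact_integrable;
      [exact: segment_compact|exact: continuous_subspaceT].
  + by apply: continuous_compact_integrable;
      [exact: segment_compact|exact: continuous_subspaceT].
  + by move=> t _; rewrite lee_fin.
- exact: continuous_subspaceT.
- split => [t _||].
  + exact: ex_derive.
  + exact/cvg_at_right_filter/cF.
  + exact/cvg_at_left_filter/cF.
- by move=> t _; rewrite derive1E derive_val.
Qed.

(** The sign [s] treats both sides of [m] at once. The derivative of the left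
    expression, with [v] replaced by [t], is
    [expR (s * al * (x - t)) * (2 * s * g * f' - al * g ^+ 2)] for
    [g = f t - f m], and
    [2 * s * g * f' - al * g ^+ 2 <= al^-1 * f' ^+ 2]. *)
Lemma weighted_square f (al m x s u v : R) : smooth f -> 0 < al -> s ^+ 2 = 1 ->
  u < v ->
  ((s * expR (s * al * (x - v)) * (f v - f m) ^+ 2 -
    s * expR (s * al * (x - u)) * (f u - f m) ^+ 2)%:E <=
   \int[leb]_(t in `[u, v])
     (al^-1 * expR (s * al * (x - t)) * derive1 f t ^+ 2)%:E)%E.
Proof.
move=> sf al0 s1 uv.
pose F' t := expR (s * al * (x - t)) *
  (2 * s * (f t - f m) * derive1 f t - s ^+ 2 * al * (f t - f m) ^+ 2).
have cf := smooth_continuous sf.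
have cf' := smooth_continuous_derive1 sf.
have ce : continuous (fun t => expR (s * al * (x - t))).
  move=> t; apply: continuous_comp; last exact: continuous_expR.
  by apply: cvgM; [exact: cvg_cst|apply: cvgB; [exact: cvg_cst|exact: cvg_id]].
have cg : continuous (fun t => f t - f m).
  by move=> t; apply: cvgB; [exact: cf|exact: cvg_cst].
pose F t := s * expR (s * al * (x - t)) * (f t - f m) ^+ 2.
pose h t := al^-1 * expR (s * al * (x - t)) * derive1 f t ^+ 2.
have csq (g : R -> R) : continuous g -> continuous (fun t => g t ^+ 2).
  by move=> cg' t; exact: (cvgM (cg' t) (cg' t)).
have dF t : is_derive t (1 : R) F (F' t).
  have df : is_derive t (1 : R) f (derive1 f t).
    by rewrite derive1E; apply/derivableP/smooth_derivable.
  apply: is_derive_eq.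
  rewrite /F' /GRing.scale/=; ring.
have cF' : continuous F'.
  move=> t; apply: cvgM; first exact: ce.
  apply: cvgB; apply: cvgM; [|exact: cf'|exact: cvg_cst|exact: (csq _ cg t)].
  by apply: cvgM; [exact: cvg_cst|exact: cg].
have ch : continuous h.
  move=> t; apply: cvgM; last exact: (csq _ cf' t).
  by apply: cvgM; [exact: cvg_cst|exact: ce].
apply: (FTC2_le uv dF cF' ch) => t.
rewrite /F' /h s1 mul1r [al^-1 * _]mulrC -[leRHS]mulrA ler_pM2l ?expR_gt0//.
rewrite -subr_ge0.
rewrite (_ : _ - _ = al^-1 * (derive1 f t - s * al * (f t - f m)) ^+ 2).
  by rewrite mulr_ge0 ?invr_ge0 ?(ltW al0)// sqr_ge0.
have -> : (derive1 f t - s * al * (f t - f m)) ^+ 2 = derive1 f t ^+ 2 -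
    2 * s * al * (f t - f m) * derive1 f t + s ^+ 2 * al ^+ 2 * (f t - f m) ^+ 2.
  ring.
by rewrite s1; field; rewrite gt_eqF.
Qed.

(** The exponential weight is what makes this better than the Cauchy-Schwarz
    bound by [`|x - m|] times the integral of [f' ^+ 2]: it can be absorbed by
    an exponentially decaying density. *)
Lemma sqr_increment_le f (al m x : R) : smooth f -> 0 < al ->
  (((f x - f m) ^+ 2)%:E <=
   \int[leb]_(t in [set t : R | (m <= t <= x)%R || (x <= t <= m)%R])
     (al^-1 * expR (al * `|x - t|) * derive1 f t ^+ 2)%:E)%E.
Proof.
move=> sf al0; have [mx|xm|<-] := ltgtP m x.
- rewrite (_ : [set t | _] = `[m, x]%classic); last first.
    apply/seteqP; split => t /=; rewrite in_itv/=; last by move=> ->.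
    by case/orP => //; lra.
  have := weighted_square m x sf al0 (expr1n _ 2) mx.
  rewrite !mul1r subrr mulr0 expR0 mul1r subrr expr0n/= mulr0 subr0.
  move=> /le_trans; apply; rewrite le_eqVlt; apply/orP; left; apply/eqP.
  apply: eq_integral => t; rewrite inE/= in_itv/= => /andP[_ tx].
  by rewrite ger0_norm// subr_ge0.
- rewrite (_ : [set t | _] = `[x, m]%classic); last first.
    apply/seteqP; split => t /=; rewrite in_itv/=; last by move=> ->; rewrite orbT.
    by case/orP => //; lra.
  have := weighted_square m x sf al0 (etrans (sqrrN 1) (expr1n _ 2)) xm.
  rewrite !mulN1r !subrr expr0n/= !mulr0 expR0 mulN1r sub0r opprK.
  move=> /le_trans; apply; rewrite le_eqVlt; apply/orP; left; apply/eqP.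
  apply: eq_integral => t; rewrite inE/= in_itv/= => /andP[xt _].
  by rewrite mulNr -mulrN ler0_norm// subr_le0.
- rewrite subrr expr0n/=; apply: integral_ge0 => t _; rewrite lee_fin.
  by rewrite mulr_ge0 ?sqr_ge0// mulr_ge0 ?expR_ge0// invr_ge0 ltW.
Qed.

End pointwise.

(** * The Laplace kernel *)

Section laplace.
Context {R : realType}.
Local Notation leb := (@lebesgue_measure R).

Lemma continuous_expR_dist (g t : R) : continuous (fun x => expR (- g * `|x - t|)).
Proof.
move=> x; apply: (@continuous_comp _ _ _ (fun x => - g * `|x - t|)); last first.
  exact: continuous_expR.
apply: cvgM; [exact: cvg_cst|apply: cvg_norm; apply: cvgB; [exact: cvg_id|exact: cvg_cst]].
Qed.

Lemma integral_expR_tail (g t : R) : 0 < g ->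
  (\int[leb]_(x in `[t, +oo[) (expR (- g * `|x - t|))%:E = (g^-1)%:E)%E.
Proof.
move=> g0; transitivity (\int[leb]_(x in `[t, +oo[) (expR (- g * (x - t)))%:E)%E.
  apply: eq_integral => x; rewrite inE/= in_itv/= andbT => tx.
  by rewrite ger0_norm// subr_ge0.
pose F x := - g^-1 * expR (- g * (x - t)).
have cF : continuous (fun x => expR (- g * (x - t))).
  move=> x; apply: (@continuous_comp _ _ _ (fun x => - g * (x - t))); last first.
    exact: continuous_expR.
  by apply: cvgM; [exact: cvg_cst|apply: cvgB; [exact: cvg_id|exact: cvg_cst]].
have dF x : is_derive x (1 : R) F (expR (- g * (x - t))).
  apply: is_derive_eq; rewrite /GRing.scale/=; field; rewrite gt_eqF//.
rewrite (@ge0_continuous_FTC2y _ _ F t 0).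
- by rewrite /F subrr mulr0 expR0 mulr1 sub0e -EFinN opprK.
- by move=> x _; rewrite expR_ge0.
- exact: continuous_subspaceT.
- rewrite -(mulr0 (- g^-1)); apply: cvgM; first exact: cvg_cst.
  rewrite (_ : (fun x => _) = (fun z => expR (- z)) \o (fun x => g * (x - t))); last first.
    by apply/funext => x /=; rewrite mulNr.
  apply: (@cvg_comp _ _ _ _ _ _ (pinfty_nbhs R)); last exact: cvgr_expR.
  apply: gt0_cvgMry => //; exact: cvg_addrr.
- by move=> x _; apply: ex_derive.
- by apply: cvgM; [exact: cvg_cst|apply/cvg_at_right_filter; exact: cF].
- by move=> x _; rewrite derive1E derive_val.
Qed.

Lemma integral_laplace_le (g t : R) : 0 < g ->
  (\int[leb]_x (expR (- g * `|x - t|))%:E <= (2 / g)%:E)%E.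
Proof.
move=> g0.
have mE : measurable_fun setT (fun x : R => (expR (- g * `|x - t|))%:E).
  apply/measurable_EFinP; apply: continuous_measurable_fun.
  exact: continuous_expR_dist.
rewrite -(setUv `]-oo, t]%classic) ge0_integral_setU//=; last 3 first.
- exact: measurableC.
- by rewrite setUv.
- exact/disj_setPCl.
rewrite (_ : 2 / g = g^-1 + g^-1); last by ring.
rewrite EFinD; apply: leeD.
  have := @ge0_integration_by_substitutionNy _ (fun x => expR (- g * `|x - t|)) (- t).
  rewrite opprK => ->.
  - rewrite -(integral_expR_tail (- t) g0) le_eqVlt; apply/orP; left; apply/eqP.
    by apply: eq_integral => x _ /=; rewrite -[in LHS]normrN opprD !opprK.
  - by apply: continuous_subspaceT; exact: continuous_expR_dist.
  - by move=> x _; rewrite expR_ge0.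
rewrite -(integral_expR_tail t g0); apply: ge0_subset_integral => //=.
- exact: measurableC.
- exact: measurable_funTS.
- by move=> x /=; rewrite !in_itv/= andbT => /negP; rewrite -ltNge => /ltW.
Qed.

End laplace.

(** * Poincare inequality under exponential decay *)

Section tonelli.
Context {R : realType}.
Local Notation leb := (@lebesgue_measure R).

(** Any [al] strictly between [0] and [be] works: the weight of
    [sqr_increment_le] grows at rate [al], and the decay of [r] at rate [be]
    leaves a Laplace kernel of rate [be - al]. *)
Lemma weighted_poincare (r f : R -> R) (al be K m : R) :
  smooth f -> 0 < al -> al < be -> 0 <= K ->
  (forall x, 0 <= r x) -> measurable_fun setT r ->
  (forall t x, (m <= t <= x) || (x <= t <= m) ->
     r x <= K * r t * expR (- be * `|x - t|)) ->
  (\int[leb]_x ((f x - f m) ^+ 2 * r x)%:E <=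
   (2 * K / (al * (be - al)))%:E * \int[leb]_x (derive1 f x ^+ 2 * r x)%:E)%E.
Proof.
move=> sf al0 albe K0 r0 mr decay.
pose btw (x t : R) := (m <= t <= x) || (x <= t <= m).
pose w (x t : R) := al^-1 * expR (al * `|x - t|) * derive1 f t ^+ 2.
pose k (z : measurableTypeR R * measurableTypeR R) : \bar R :=
  (if btw z.1 z.2 then w z.1 z.2 * r z.1 else 0)%:E.
have w0 x t : 0 <= w x t.
  by rewrite mulr_ge0 ?sqr_ge0// mulr_ge0 ?expR_ge0// invr_ge0 ltW.
have k0 z : (0 <= k z)%E.
  by rewrite /k; case: ifP => // _; rewrite lee_fin mulr_ge0.
have md : measurable_fun setT (derive1 f).
  by apply: continuous_measurable_fun; exact: smooth_continuous_derive1.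
have mk : measurable_fun setT k.
  apply/measurable_EFinP; apply: measurable_fun_ifT => //=.
  - by apply: measurable_or; apply: measurable_and; apply: measurable_fun_ler.
  - apply: measurable_funM; last exact: measurableT_comp.
    apply: measurable_funM; last first.
      by apply/measurable_funX/measurableT_comp.
    apply: measurable_funM => //; apply: measurableT_comp => //.
    apply: measurable_funM => //; apply: measurableT_comp => //.
    exact: measurable_funB.
have mexp g t : measurable_fun setT (fun x : R => expR (g * `|x - t|)).
  rewrite -(opprK g); apply: continuous_measurable_fun.
  exact: continuous_expR_dist.
apply: (@le_trans _ _ (\int[leb]_x \int[leb]_t k (x, t))%E).
  apply: ge0_le_integral => //.
  - by move=> x _; rewrite lee_fin mulr_ge0 ?sqr_ge0.
  - apply/measurable_EFinP; apply: measurable_funM => //.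
    apply: measurable_funX; apply: measurable_funB => //.
    by apply: continuous_measurable_fun; exact: smooth_continuous.
  - exact: (measurable_fun_fubini_tonelli_F k).
  - move=> x _; rewrite EFinM muleC.
    apply: (le_trans (lee_wpmul2l _ (sqr_increment_le m x sf al0))).
      by rewrite lee_fin; exact: r0.
    rewrite -ge0_integralZl//=; last 4 first.
    + rewrite (_ : [set t : R | _] = `[m, x]%classic `|` `[x, m]%classic).
        exact: measurableU.
      by apply/seteqP; split => t /=; rewrite !in_itv/= => /orP.
    + apply/measurable_EFinP; apply: measurable_funTS.
      under eq_fun do rewrite distrC.
      apply: measurable_funM; last exact: measurable_funX.
      by apply: measurable_funM => //; exact: mexp.
    + by move=> t _; rewrite lee_fin; exact: w0.
    + by rewrite lee_fin; exact: r0.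
    rewrite integral_mkcond le_eqVlt; apply/orP; left; apply/eqP.
    apply: eq_integral => t _; rewrite patchE (_ : (t \in _) = btw x t); last first.
      by apply/idP/idP; rewrite inE.
    by rewrite /k /=; case: (btw x t) => //; rewrite -EFinM mulrC.
rewrite (fubini_tonelli k mk k0).
have mfr : measurable_fun setT (fun x : R => (derive1 f x ^+ 2 * r x)%:E).
  by apply/measurable_EFinP; apply: measurable_funM => //; exact: measurable_funX.
have fr0 x : 0 <= derive1 f x ^+ 2 * r x by rewrite mulr_ge0 ?sqr_ge0.
have c0 : 0 <= 2 * K / (al * (be - al)).
  by rewrite divr_ge0 ?mulr_ge0 ?subr_ge0// ltW.
rewrite -ge0_integralZl//=; last first.
  by move=> x _; rewrite lee_fin.
apply: ge0_le_integral => //.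
- by move=> t _; apply: integral_ge0.
- exact: (measurable_fun_fubini_tonelli_G k).
- exact: measurable_funeM.
move=> t _.
have ct0 : 0 <= al^-1 * K * (derive1 f t ^+ 2 * r t).
  by rewrite mulr_ge0 ?fr0// mulr_ge0 ?K0// invr_ge0 ltW.
apply: (@le_trans _ _ (\int[leb]_x
    ((al^-1 * K * (derive1 f t ^+ 2 * r t))%:E *
     (expR (- (be - al) * `|x - t|))%:E))%E).
  apply: ge0_le_integral => //.
  - apply: measurableT_comp => //; exact: pair2_measurable.
  - by apply: measurable_funeM; apply/measurable_EFinP; exact: mexp.
  - move=> x _; rewrite /k -EFinM lee_fin /=; case: ifPn => [b|_].
      apply: (le_trans (ler_wpM2l (w0 x t) (decay t x b))).
      rewrite (_ : - (be - al) * `|x - t| = al * `|x - t| + - be * `|x - t|); last by ring.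
      by rewrite expRD /w le_eqVlt; apply/orP; left; apply/eqP; ring.
    by rewrite mulr_ge0 ?expR_ge0.
rewrite ge0_integralZl//=; last by apply/measurable_EFinP; exact: mexp.
apply: (le_trans (lee_wpmul2l _ (integral_laplace_le _ _))).
- by rewrite lee_fin.
- by rewrite subr_gt0.
rewrite -!EFinM lee_fin le_eqVlt; apply/orP; left; apply/eqP.
by field; rewrite !gt_eqF// subr_gt0.
Qed.

End tonelli.

(** * Bounds on variances *)

Section variance.
Context {R : realType}.
Local Notation leb := (@lebesgue_measure R).

Lemma Lfun2_of_integral_sqr d (T : measurableType d) (P : {measure set T -> \bar R})
    (X : T -> R) : measurable_fun setT X ->
  (\int[P]_x (X x ^+ 2)%:E < +oo)%E -> X \in Lfun P 2%:E.
Proof.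
move=> mX X2; apply/andP; split; rewrite inE//= /finite_norm unlock /Lnorm.
rewrite poweR_lty//; apply: le_lt_trans X2; rewrite le_eqVlt; apply/orP; left.
apply/eqP/eq_integral => x _ /=.
by rewrite powR_mulrn// real_normK// num_real.
Qed.

(** Valid without integrability: either the right-hand side is infinite, or [X]
    is square integrable and the two sides differ by [(E[X] - a) ^+ 2]. *)
Lemma variance_le_sqr_dist d (T : measurableType d) (P : probability T R)
    (X : T -> R) (a : R) : measurable_fun setT X ->
  ('V_P[X] <= \int[P]_x ((X x - a) ^+ 2)%:E)%E.
Proof.
move=> mX; have [->|/eqP] := eqVneq (\int[P]_x ((X x - a) ^+ 2)%:E)%E +oo%E.
  exact: leey.
move=> /eqP; rewrite -ltey => fin.
have Y2 : (X \- cst a)%R \in Lfun P 2%:E.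
  by apply: Lfun2_of_integral_sqr => //; exact: measurable_funB.
have X2 : X \in Lfun P 2%:E.
  rewrite (_ : X = (X \- cst a) \+ cst a)%R; last first.
    by apply/funext => x /=; rewrite subrK.
  by rewrite rpredD ?lee1n//= => _; exact: Lfun_cst.
rewrite -(varianceB_cst_r a X2) varianceE//.
have -> : ('E_P[(X \- cst a) ^+ 2] = \int[P]_x ((X x - a) ^+ 2)%:E)%E.
  by rewrite unlock.
rewrite -[leRHS]sube0; apply: leeB => //; exact: sqre_ge0.
Qed.

(** The interval of radius [1 / (4 * M)] around the mean has mass at most
    [1 / 2]; Chebyshev's inequality bounds the mass outside. *)
Lemma variance_id_ge (mu : probability (measurableTypeR R) R) (r : R -> R) (M : R) :
  (forall x, 0 <= r x) -> measurable_fun setT r -> has_density mu r ->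
  0 < M -> (forall x, r x <= M) ->
  (((32 * M ^+ 2)^-1)%:E <= 'V_mu[fun x : R => x])%E.
Proof.
move=> r0 mr muE M0 rM.
pose c := fine ('E_mu[fun x : R => x])%E.
pose de := (4 * M)^-1.
have de0 : 0 < de by rewrite invr_gt0 mulr_gt0.
pose A : set (measurableTypeR R) := [set x : R | de <= `|x - c|].
have AE : ~` A = `]c - de, c + de[%classic.
  apply/seteqP; split => x /=; rewrite in_itv/=.
    by move=> /negP; rewrite -ltNge ltr_distl.
  by move=> h; apply/negP; rewrite -ltNge ltr_distl.
have mA : measurable A by rewrite -(setCK A) AE; exact: measurableC.
have cheb : (mu A <= (de ^- 2)%:E * 'V_mu[fun x : R => x])%E.
  have mid : (fun x : measurableTypeR R => x : R) \in @mfun _ _ (measurableTypeR R) R.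
    by rewrite inE; exact: measurable_id.
  exact: (@chebyshev _ _ _ mu (mfun_Sub mid) de de0).
have muC : (mu (~` A) <= (2^-1)%:E)%E.
  rewrite muE; last exact: measurableC.
  apply: (@le_trans _ _ (\int[leb]_(x in ~` A) M%:E)%E).
    apply: ge0_le_integral => //.
    - exact: measurableC.
    - by move=> x _; rewrite lee_fin; exact: r0.
    - by apply/measurable_EFinP; exact: measurable_funTS.
    - by move=> x _; rewrite lee_fin; exact: rM.
  rewrite AE integral_cst//= lebesgue_measure_itv/= lte_fin ifT; last lra.
  rewrite -EFinD -EFinM lee_fin.
  rewrite (_ : M * (c + de - (c - de)) = 2^-1)// /de; field; lra.
have : (1 <= (2^-1)%:E + (de ^- 2)%:E * 'V_mu[fun x : R => x])%E.
  rewrite -(probability_setT mu) -(setvU A) measureU//; last 2 first.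
  - exact: measurableC.
  - by rewrite setICl.
  exact: leeD.
case: 'V_mu[_]%E => [v| |] //=.
  rewrite -EFinM -EFinD !lee_fin => h.
  rewrite -(ler_pM2l (_ : 0 < de ^- 2)) ?invr_gt0 ?exprn_gt0//.
  rewrite (_ : _ * _ = 2^-1); first lra.
  by rewrite /de; field; lra.
- by move=> _; exact: leey.
- by rewrite mulrNy gtr0_sg ?invr_gt0 ?exprn_gt0// mul1e addeNy.
Qed.

End variance.

(** * Comparison of the Poincare constant with the variance *)

Lemma log_concave_poincare_ineq (R : realType)
    (mu : probability (measurableTypeR R) R) : log_concave mu ->
  exists2 c : R, 0 <= c & poincare_ineq mu c /\
    (c%:E <= (2048 * expR 5)%:E * 'V_mu[fun x : R => x])%E.
Proof.
move=> /log_concave_density[r [r0 lr muE]].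
have mr := log_concave_fun_measurable lr.
have mass := density_mass_le1 r0 mr muE.
have [a [b [ab ra rb]]] := density_support r0 mr muE.
have [M rM] := log_concave_fun_bounded lr mass ab ra rb.
have [m rm rmax] := exists_near_max ra rM.
pose B := r m * expR (-2).
have B0 : 0 < B by rewrite mulr_gt0 ?expR_gt0.
(* The constant of [weighted_poincare] for [be = B], [K = 2 * expR 1] and the
   optimal [al = B / 2]. *)
pose c := 2 * (2 * expR 1) / (B / 2 * (B - B / 2)).
have cE : c = 16 * expR 5 / r m ^+ 2.
  rewrite /c (_ : B / 2 * (B - B / 2) = B ^+ 2 / 4); last by field.
  have -> : expR 5 = expR 1 * expR 2 * expR 2 :> R.
    by rewrite -!expRD; congr expR; ring.
  by rewrite /B expRN; field; rewrite !gt_eqF ?expR_gt0.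
exists c.
  by rewrite cE divr_ge0 ?mulr_ge0 ?expR_ge0// sqr_ge0.
split.
  move=> f sf; have mf : measurable_fun setT f.
    by apply: continuous_measurable_fun; exact: smooth_continuous.
  apply: (le_trans (variance_le_sqr_dist mu (f m) mf)).
  rewrite !(integral_of_density r0 mr muE)//.
  - under eq_integral do rewrite -EFinM.
    under [in leRHS]eq_integral do rewrite -EFinM.
    apply: (weighted_poincare (be := B)) => //.
    + by rewrite divr_gt0.
    + by lra.
    + by move=> t x tx; exact: log_concave_fun_decay_sym.
  - by move=> x; rewrite lee_fin sqr_ge0.
  - apply/measurable_EFinP; apply: measurable_funX.
    by apply: continuous_measurable_fun; exact: smooth_continuous_derive1.
  - by move=> x; rewrite lee_fin sqr_ge0.
  - by apply/measurable_EFinP; apply: measurable_funX; exact: measurable_funB.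
(* [r <= 2 * r m] gives the variance at least [1 / (128 * r m ^+ 2)], and
   [16 * 128 = 2048]. *)
have rm2 : 0 < 2 * r m by rewrite mulr_gt0.
apply: (le_trans _ (lee_wpmul2l _ (variance_id_ge r0 mr muE rm2 rmax))).
  rewrite -EFinM lee_fin cE le_eqVlt; apply/orP; left; apply/eqP.
  by field; rewrite gt_eqF.
rewrite lee_fin; exact: (mulr_ge0 (ler0n _ _) (expR_ge0 _)).
Qed.

Theorem theorem4p14 (R : realType) :
  exists C : R, forall mu : probability (measurableTypeR R) R,
    log_concave mu ->
    (poincare_constant mu <= C%:E * 'V_mu[fun x : R => x])%E.
Proof.
exists (2048 * expR 5) => mu /log_concave_poincare_ineq[c c0 [pc cV]].
by apply: le_trans cV; apply: ereal_inf_lbound; exists c.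
Qed.
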